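(* Let $a=(a_k)_{k\ge1}$ and $b=(b_k)_{k\ge1}$ be sequences of complex numbers with $a_1=b_1=0$, and let $\mu$ be a strict partition. Then $$Q_{\mu;a}=\sum_{\nu\in DP,\ \ell(\nu)=\ell(\mu),\ \nu\subset\mu}d_{\mu\nu}\,Q_{\nu;b},\qquad d_{\mu\nu}=\det\bigl((d_{\mu_i\nu_j}(a,b))_{1\le i,j\le\ell(\mu)}\bigr).$$
   Context: $DP$ is the set of strict partitions $\lambda=(\lambda_1>\dots>\lambda_l>0)$, $\ell(\lambda)=l$; $\nu\subset\mu$ means $\ell(\nu)\le\ell(\mu)$ and $\nu_i\le\mu_i$ for $i\le\ell(\nu)$. Put $(x\mid c)^k=\prod_{m=1}^k(x-c_m)$ for a sequence $c$. For $\lambda\in DP$ and $m\ge\ell(\lambda)=l$, $$P_{\lambda;c}(x_1,\dots,x_m)=\frac1{(m-l)!}\sum_{\omega\in S(m)}\prod_{i=1}^l (x_{\omega(i)}\mid c)^{\lambda_i}\prod_{1\le i\le l,\ i<j\le m}\frac{x_{\omega(i)}+x_{\omega(j)}}{x_{\omega(i)}-x_{\omega(j)}},$$ and $0$ if $m<l$, defining an element $P_{\lambda;c}$ of the algebra $\Gamma$ of supersymmetric functions (stable sequences of supersymmetric polynomials); $Q_{\lambda;c}=2^{\ell(\lambda)}P_{\lambda;c}$. Super complete homogeneous functions: $\sum_{k\ge0}h_k(y_1,\dots,y_p;z_1,\dots,z_q)t^k=\prod_{m=1}^q(1+z_mt)\big/\prod_{m=1}^p(1-y_mt)$. For integers $r\ge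 r'\ge0$ put $d_{rr'}(a,b)=h_{r-r'}(b_2,\dots,b_{r'+1};-a_2,\dots,-a_r)$, and $d_{rr'}(a,b)=0$ if $r<r'$. *)

(* Defs.v *)
From HB Require Import structures.
From mathcomp Require Import all_boot all_order all_algebra all_fingroup.
From mathcomp Require Import fraction.
From mathcomp Require Import boolp classical_sets cardinality fsbigop.
From mathcomp Require Import mpoly.

(* A sequence (c_k)_{k >= 1} is a function c : nat -> K; the value c 0 is never
   used. Polynomials in x_1, ..., x_m are elements of {mpoly K[m]}, with
   'X_i (i : 'I_m) standing for x_{i+1}. *)

Set Implicit Arguments.
Unset Strict Implicit.
Unset Printing Implicit Defensive.

Import GRing.Theory Num.Theory.
Local Open Scope ring_scope.

Record strict_partition := StrictPartition {
  parts :> seq nat;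
  _ : sorted gtn parts && all (ltn 0) parts }.

HB.instance Definition _ := [isSub for parts].
HB.instance Definition _ := [Countable of strict_partition by <:].

Definition part_sub (nu mu : seq nat) : Prop :=
  (size nu <= size mu)%N /\
  forall i, (i < size nu)%N -> (nth 0 nu i <= nth 0 mu i)%N.

Lemma strict_partition_gt0 (lam : strict_partition) i :
  (i < size lam)%N -> (0 < nth 0 lam i)%N.
Proof. by case: lam => s /= /andP[_ /(all_nthP 0%N)]; apply. Qed.

Lemma finite_subpartitions (mu : strict_partition) :
  finite_set [set nu : strict_partition | size nu = size mu /\ part_sub nu mu].
Proof.
pose l := size mu; pose M := (\max_(x <- mu) x).+1.
pose f (t : l.-tuple 'I_M) : seq nat := map val (tval t).
apply: (@sub_finite_set _ _
  [set nu : strict_partition | parts nu \in map f (enum {: l.-tuple 'I_M})]).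
  move=> nu /= [e [_ le]].
  have hM x : x \in (nu : seq nat) -> (x < M)%N.
    move=> /(nthP 0%N)[i il <-]; rewrite /M ltnS.
    apply: leq_trans (le _ il) _.
    have /leq_bigmax_seq : nth 0%N mu i \in (mu : seq nat) by rewrite mem_nth // -e.
    exact.
  have sz : size [seq (inord x : 'I_M) | x <- nu] == l by rewrite size_map e.
  apply/mapP; exists (Tuple sz); first by rewrite mem_enum.
  rewrite /f /= -map_comp -[LHS]map_id; apply/eq_in_map => x xnu /=.
  by rewrite inordK // hM.
pose g (s : seq nat) : strict_partition := insubd (StrictPartition (erefl : sorted gtn [::] && all (ltn 0) [::])) s.
apply: (@sub_finite_set _ _ [set` map g (map f (enum {: l.-tuple 'I_M}))]).
  move=> nu /= h; apply/mapP; exists (parts nu) => //.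
  by rewrite /g valKd.
exact: finite_seq.
Qed.

Section FactorialP.
Variable K : numFieldType.
Implicit Types (c : nat -> K) (lam : seq nat).

Definition fact_power (c : nat -> K) n (k : nat) (x : {mpoly K[n]}) :
    {mpoly K[n]} :=
  \prod_(1 <= i < k.+1) (x - (c i)%:MP).

(* The defining symmetrization formula of P_{lam;c}, with the variables
   x_1, ..., x_m replaced by polynomials in n variables; it is meaningful when
   the x_i are pairwise distinct. The case x = 'X_ is the definition itself,
   an identity in the field of rational functions. *)
Definition P_at lam c m n (x : 'I_m -> {mpoly K[n]}) :
    {fraction {mpoly K[n]}} :=
  if (size lam <= m)%N then
    ((m - size lam)`!)%:R^-1 *
    \sum_(w : 'S_m)
      (\prod_(i < m | (i < size lam)%N)
          tofrac (fact_power c (nth 0%N lam i) (x (w i)))) *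
      (\prod_(i < m | (i < size lam)%N) \prod_(j < m | (i < j)%N)
          (tofrac (x (w i) + x (w j)) / tofrac (x (w i) - x (w j))))
  else 0.

Section Clear.
Variables (lam : seq nat) (c : nat -> K) (m : nat).
Local Notation l := (size lam).

Let term n (x : 'I_m -> {mpoly K[n]}) (w : 'S_m) : {fraction {mpoly K[n]}} :=
  (\prod_(i < m | (i < l)%N) tofrac (fact_power c (nth 0%N lam i) (x (w i)))) *
  (\prod_(i < m | (i < l)%N) \prod_(j < m | (i < j)%N)
     (tofrac (x (w i) + x (w j)) / tofrac (x (w i) - x (w j)))).

Let num n (x : 'I_m -> {mpoly K[n]}) (w : 'S_m) : {mpoly K[n]} :=
  (\prod_(i < m | (i < l)%N) fact_power c (nth 0%N lam i) (x (w i))) *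
  (\prod_(i < m | (i < l)%N) \prod_(j < m | (i < j)%N) (x (w i) + x (w j))).

Let den n (x : 'I_m -> {mpoly K[n]}) (w : 'S_m) : {mpoly K[n]} :=
  \prod_(i < m | (i < l)%N) \prod_(j < m | (i < j)%N) (x (w i) - x (w j)).

Let cod n (x : 'I_m -> {mpoly K[n]}) (w : 'S_m) : {mpoly K[n]} :=
  \prod_(i < m | ~~ (i < l)%N) \prod_(j < m | (i < j)%N) (x (w i) - x (w j)).

Let van n (x : 'I_m -> {mpoly K[n]}) : {mpoly K[n]} :=
  \prod_(i < m) \prod_(j < m | (i < j)%N) (x i - x j).

Let alt n (x : 'I_m -> {mpoly K[n]}) : {mpoly K[n]} :=
  \sum_(w : 'S_m) (-1) ^+ w * (num x w * cod x w).

Lemma van_perm n (x : 'I_m -> {mpoly K[n]}) (w : 'S_m) :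
  van (fun i => x (w i)) = (-1) ^+ w * van x.
Proof.
have E (y : 'I_m -> {mpoly K[n]}) :
    van y = \det (Vandermonde m (\row_i - y i)).
  rewrite det_Vandermonde; apply: eq_bigr => i _; apply: eq_bigr => j _.
  by rewrite !mxE opprK addrC.
rewrite !E.
have -> : Vandermonde m (\row_i - x (w i)) =
          col_perm w (Vandermonde m (\row_i - x i)).
  by apply/matrixP=> i j; rewrite !mxE.
by rewrite col_permE det_mulmx det_perm odd_permV mulrC.
Qed.

Lemma van_split n (x : 'I_m -> {mpoly K[n]}) (w : 'S_m) :
  van (fun i => x (w i)) = den x w * cod x w.
Proof. by rewrite /van (bigID (fun i : 'I_m => (i < l)%N)). Qed.

Lemma prod_neq0 n (x : 'I_m -> {mpoly K[n]}) (P : pred 'I_m) (w : 'S_m) :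
  injective x ->
  \prod_(i < m | P i) \prod_(j < m | (i < j)%N) (x (w i) - x (w j)) != 0.
Proof.
move=> xI; apply/prodf_neq0 => i _; apply/prodf_neq0 => j ij.
rewrite subr_eq0; apply/eqP => /xI /perm_inj e.
by rewrite e ltnn in ij.
Qed.

Lemma van_neq0 n (x : 'I_m -> {mpoly K[n]}) : injective x -> van x != 0.
Proof.
move=> xI; have := prod_neq0 xpredT 1%g xI.
by under eq_bigr do under eq_bigr do rewrite !perm1.
Qed.

Lemma termE n (x : 'I_m -> {mpoly K[n]}) (w : 'S_m) : injective x ->
  term x w = tofrac ((-1) ^+ w * (num x w * cod x w)) / tofrac (van x).
Proof.
move=> xI; have V0 := van_neq0 xI.
have D0 : den x w != 0 by exact: prod_neq0.
have -> : term x w = tofrac (num x w) / tofrac (den x w).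
  rewrite /term /num /den tofracM -!mulrA; congr (_ * _).
    by rewrite rmorph_prod.
  rewrite !rmorph_prod -prodf_div; apply: eq_bigr => i _.
  by rewrite !rmorph_prod -prodf_div.
apply/eqP; rewrite eqr_div ?tofrac_eq0 // -!tofracM; apply/eqP; congr tofrac.
have -> : van x = (-1) ^+ w * (den x w * cod x w).
  by rewrite -van_split van_perm mulrA -expr2 sqrr_sign mul1r.
by rewrite mulrCA -!mulrA [cod x w * _]mulrC.
Qed.

Lemma sum_termE n (x : 'I_m -> {mpoly K[n]}) : injective x ->
  \sum_(w : 'S_m) term x w = tofrac (alt x) / tofrac (van x).
Proof.
move=> xI; rewrite /alt rmorph_sum /= mulr_suml.
by apply: eq_bigr => w _; rewrite termE.
Qed.

Let X (i : 'I_m) : {mpoly K[m]} := 'X_i.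

Lemma mpolyX_inj : injective X.
Proof.
move=> i j /(congr1 (fun p => p@_U_(j))); rewrite !mcoeffXU eqxx.
by case: eqP => // _ /eqP; rewrite eq_sym oner_eq0.
Qed.

Lemma comp_alt n (x : 'I_m -> {mpoly K[n]}) :
  alt X \mPo [tuple x k | k < m] = alt x.
Proof.
have cX k : X k \mPo [tuple x k | k < m] = x k.
  by rewrite comp_mpolyXU -tnth_nth tnth_mktuple.
rewrite /alt raddf_sum; apply: eq_bigr => w _ /=.
rewrite !rmorphM /= rmorphXn rmorphN1; congr (_ * (_ * _ * _)).
- rewrite rmorph_prod; apply: eq_bigr => i _.
  rewrite rmorph_prod; apply: eq_bigr => k _.
  by rewrite rmorphB /= cX comp_mpolyC.
- rewrite rmorph_prod; apply: eq_bigr => i _.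
  by rewrite rmorph_prod; apply: eq_bigr => j _; rewrite rmorphD /= !cX.
- rewrite rmorph_prod; apply: eq_bigr => i _.
  by rewrite rmorph_prod; apply: eq_bigr => j _; rewrite rmorphB /= !cX.
Qed.

Lemma comp_van n (x : 'I_m -> {mpoly K[n]}) :
  van X \mPo [tuple x k | k < m] = van x.
Proof.
have cX k : X k \mPo [tuple x k | k < m] = x k.
  by rewrite comp_mpolyXU -tnth_nth tnth_mktuple.
rewrite rmorph_prod; apply: eq_bigr => i _.
by rewrite rmorph_prod; apply: eq_bigr => j _; rewrite rmorphB /= !cX.
Qed.

Lemma P_atE n (x : 'I_m -> {mpoly K[n]}) : injective x ->
  P_at lam c x = if (l <= m)%N then
    tofrac ((((m - l)`!)%:R^-1)%:MP * alt x) / tofrac (van x) else 0.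
Proof.
move=> xI; rewrite /P_at; case: ifP => // _.
rewrite (sum_termE xI) tofracM mulrA; congr (_ * _ * _).
apply: (mulfI (x := ((m - l)`!)%:R)).
  rewrite -(rmorph_nat (tofrac (R:={mpoly K[n]}))) tofrac_eq0.
  by rewrite -(rmorph_nat (@mpolyC n K)) mpolyC_eq0 pnatr_eq0 -lt0n fact_gt0.
have F0 : ((m - l)`!)%:R != 0 :> K by rewrite pnatr_eq0 -lt0n fact_gt0.
rewrite mulfV; last first.
  rewrite -(rmorph_nat (tofrac (R:={mpoly K[n]}))) tofrac_eq0.
  by rewrite -(rmorph_nat (@mpolyC n K)) mpolyC_eq0.
rewrite -(rmorph_nat (tofrac (R:={mpoly K[n]}))) -tofracM.
by rewrite -(rmorph_nat (@mpolyC n K)) -mpolyCM mulfV // mpolyC1 tofrac1.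
Qed.

Let merge (i j : 'I_m) (k : 'I_m) : {mpoly K[m]} :=
  if k == j then 'X_i else 'X_k.

Lemma alt_merge (i j : 'I_m) : i != j -> alt (merge i j) = 0.
Proof.
move=> nij; set x := merge i j.
have xt k : x (tperm i j k) = x k.
  rewrite /x /merge; case: tpermP => [->|->|_ _] //.
    by rewrite eqxx (negbTE nij).
  by rewrite eqxx (negbTE nij).
have : alt x = - alt x.
  rewrite {1}/alt (reindex_inj (mulIg (tperm i j))) /= -sumrN.
  apply: eq_bigr => w _; rewrite odd_permM odd_tperm nij addbT signrN mulNr.
  have -> : num x (w * tperm i j)%g = num x w.
    rewrite /num; congr (_ * _); apply: eq_bigr => k _.
      by rewrite permM xt.
    by apply: eq_bigr => k' _; rewrite !permM !xt.
  have -> // : cod x (w * tperm i j)%g = cod x w.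
  by apply: eq_bigr => k _; apply: eq_bigr => k' _; rewrite !permM !xt.
move/eqP; rewrite -addr_eq0 -mulr2n => /eqP e; apply/mpolyP => d.
have /eqP := congr1 (fun p => p@_d) e.
by rewrite mcoeffMn mcoeff0 mulrn_eq0 /= => /eqP.
Qed.

Lemma merge_dvd (i j : 'I_m) (p : {mpoly K[m]}) :
  exists q, p - (p \mPo [tuple merge i j k | k < m]) = ('X_i - 'X_j) * q.
Proof.
pose D p := exists q : {mpoly K[m]},
  p - (p \mPo [tuple merge i j k | k < m]) = ('X_i - 'X_j) * q.
have DC a : D a%:MP by exists 0; rewrite comp_mpolyC subrr mulr0.
have DX k : D 'X_k.
  rewrite /D comp_mpolyXU -tnth_nth tnth_mktuple /merge.
  case: eqP => [->|_]; last by exists 0; rewrite subrr mulr0.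
  by exists (-1); rewrite mulrN1 opprB.
have DD p1 p2 : D p1 -> D p2 -> D (p1 + p2).
  move=> [q1 e1] [q2 e2]; exists (q1 + q2).
  by rewrite rmorphD /= opprD addrACA e1 e2 mulrDr.
have DM p1 p2 : D p1 -> D p2 -> D (p1 * p2).
  move=> [q1 e1] [q2 e2]; rewrite /D rmorphM /=.
  exists (q1 * p2 + (p1 \mPo [tuple merge i j k | k < m]) * q2).
  rewrite mulrDr mulrA -e1 mulrCA -e2 mulrBr mulrBl.
  by rewrite addrA subrK.
have DE k d : D ('X_k ^+ d).
  elim: d => [|d IH]; first by rewrite expr0 -mpolyC1.
  by rewrite exprS; apply: DM.
elim/mpolyind: p => [|a d p _ _ IH]; first by exact: (DC 0).
apply: DD; last exact: IH.
rewrite -mul_mpolyC; apply: (DM _ _ (DC a)).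
rewrite mpolyXE_id; apply: (big_ind D).
- by rewrite -mpolyC1; apply: DC.
- exact: DM.
- by move=> k _; apply: DE.
Qed.

Lemma van_dvd_alt : exists q, alt X = van X * q.
Proof.
pose s := [seq ij : 'I_m * 'I_m <- enum {: 'I_m * 'I_m} | (ij.1 < ij.2)%N].
have -> : van X = \prod_(ij <- s) (X ij.1 - X ij.2).
  rewrite /van pair_big_dep /= big_filter big_enum_cond /=.
  by apply: eq_bigl => -[i j].
have s_lt : all (fun ij : 'I_m * 'I_m => (ij.1 < ij.2)%N) s by rewrite filter_all.
have : uniq s by rewrite filter_uniq // enum_uniq.
elim: s s_lt => [|[i j] s IH] /=; first by exists (alt X); rewrite big_nil mul1r.
move=> /andP[ij s_lt] /andP[ijNs us].
have {IH}[//|q e] := IH s_lt.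
have nij : i != j by apply: contraTneq ij => ->; rewrite ltnn.
have [q' e'] := merge_dvd i j q.
exists q'; rewrite big_cons /= e -mulrA mulrCA -e'.
suff -> : q \mPo [tuple merge i j k | k < m] = 0 by rewrite subr0.
have := congr1 (comp_mpoly [tuple merge i j k | k < m]) e.
rewrite comp_alt alt_merge // rmorphM /= => /esym/eqP.
rewrite mulf_eq0 => /orP[|/eqP //]; rewrite rmorph_prod.
rewrite (big_nth (i, j)) big_mkord prodf_seq_eq0.
case/hasP => -[k lek] _ /=.
have := mem_nth (i, j) lek; case: (nth _ _ _) => [u v] /= uvs.
rewrite rmorphB /= !comp_mpolyXU -!tnth_nth !tnth_mktuple subr_eq0 /merge.
have /= uv := allP s_lt _ uvs.
case: (eqVneq u j) => [uj|uj]; case: (eqVneq v j) => [vj|vj] /eqP /mpolyX_inj E.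
- by rewrite uj vj ltnn in uv.
- by rewrite -E uj in uv; have := ltn_trans uv ij; rewrite ltnn.
- by subst; rewrite uvs in ijNs.
- by rewrite E ltnn in uv.
Qed.

Lemma P_poly_exists : exists p : {mpoly K[m]}, tofrac p == P_at lam c X.
Proof.
rewrite (P_atE mpolyX_inj); case: ifP => _; last by exists 0; rewrite tofrac0.
have [q ->] := van_dvd_alt.
exists ((((m - l)`!)%:R^-1)%:MP * q).
rewrite eq_sym mulrCA tofracM [tofrac (van X) * _]mulrC mulfK //.
by rewrite tofrac_eq0 van_neq0 //; apply: mpolyX_inj.
Qed.

(* The polynomial equal to the rational function given by the formula; it is
   unique because tofrac is injective. *)
Definition P_poly : {mpoly K[m]} := xchoose P_poly_exists.

Lemma P_polyE : tofrac P_poly = P_at lam c X.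
Proof. exact/eqP/(xchooseP P_poly_exists). Qed.

Lemma P_poly_comp n (x : 'I_m -> {mpoly K[n]}) : injective x ->
  tofrac (P_poly \mPo [tuple x k | k < m]) = P_at lam c x.
Proof.
move=> xI; rewrite (P_atE xI).
have := P_polyE; rewrite (P_atE mpolyX_inj); case: ifP => _; last first.
  by move=> /eqP; rewrite tofrac_eq0 => /eqP ->; rewrite rmorph0 tofrac0.
have V0 : tofrac (van X) != 0.
  by rewrite tofrac_eq0 van_neq0 //; apply: mpolyX_inj.
move=> /(congr1 (fun f => f * tofrac (van X))); rewrite divfK // => /eqP.
rewrite -tofracM tofrac_eq => /eqP.
move=> /(congr1 (comp_mpoly [tuple x k | k < m])).
rewrite !(rmorphM (comp_mpoly _)) /= comp_alt comp_van comp_mpolyC => <-.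
by rewrite tofracM mulfK // tofrac_eq0 van_neq0.
Qed.

End Clear.
End FactorialP.

Section Super.
Variable K : numFieldType.
Implicit Types (c : nat -> K) (lam : seq nat).

(* The point (x_1, ..., x_m) with x_i := t and x_j := - t. *)
Definition cancel_point m (i j : 'I_m) (t : {mpoly K[m]}) (k : 'I_m) :
    {mpoly K[m]} :=
  if k == i then t else if k == j then - t else 'X_k.

(* Symmetric, and f(..., t, ..., -t, ...) does not depend on t: after the
   substitution x_j := - x_i, the remaining variable 'X_i plays the role of t. *)
Definition supersymmetric m (f : {mpoly K[m]}) : Prop :=
  f \is symmetric /\
  forall i j : 'I_m, i != j ->
    f \mPo [tuple cancel_point i j 'X_i k | k < m] =
    f \mPo [tuple cancel_point i j 0 k | k < m].

(* f_{m+1}(x_1, ..., x_m, 0) = f_m(x_1, ..., x_m). *)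
Definition stable (f : forall m, {mpoly K[m]}) : Prop :=
  forall m, f m.+1 \mPo [tuple oapp (fun j : 'I_m => 'X_j) 0 (unlift ord_max k)
                        | k < m.+1] = f m.

Lemma comp_mpoly_comp m n r (l1 : m.-tuple {mpoly K[n]})
    (l2 : n.-tuple {mpoly K[r]}) (p : {mpoly K[m]}) :
  (p \mPo l1) \mPo l2 = p \mPo [tuple tnth l1 i \mPo l2 | i < m].
Proof.
rewrite (comp_mpolyE p l1) (comp_mpolyE p) raddf_sum; apply: eq_bigr => d _ /=.
rewrite comp_mpolyZ rmorph_prod; congr (_ *: _); apply: eq_bigr => i _.
by rewrite rmorphXn tnth_mktuple.
Qed.

Lemma P_poly_sym lam c m : P_poly lam c m \is symmetric.
Proof.
apply/issymP => s.
rewrite -[LHS]comp_mpoly_id msym_mPo.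
under eq_mktuple => i do rewrite tnth_mktuple.
apply/eqP; rewrite -tofrac_eq (P_poly_comp lam c (x := fun i => 'X_(s i))).
  rewrite P_polyE; apply/eqP; rewrite /P_at; case: ifP => // _.
  congr (_ * _); rewrite [RHS](reindex_inj (mulIg s)) /=.
  apply: eq_bigr => w _; congr (_ * _); apply: eq_bigr => i _.
    by rewrite permM.
  by apply: eq_bigr => j _; rewrite !permM.
by move=> i j /mpolyX_inj /perm_inj.
Qed.

Lemma mpolyX_neqN m (i j : 'I_m) : 'X_i != - 'X_j :> {mpoly K[m]}.
Proof.
apply/eqP => /(congr1 (fun p => p@_U_(i))); rewrite mcoeffN !mcoeffXU eqxx.
by move/eqP; rewrite -addr_eq0 -natrD pnatr_eq0.
Qed.

Lemma cancel_point_inj m (i j : 'I_m) (u : 'I_m) :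
  i != j -> (u == i) || (u == j) -> injective (cancel_point i j 'X_u).
Proof.
move=> nij uij a b; rewrite /cancel_point.
have XN k k' : 'X_k = - 'X_k' :> {mpoly K[m]} -> False.
  by move/eqP; rewrite (negbTE (mpolyX_neqN _ _)).
have U k : k != i -> k != j -> 'X_u = 'X_k :> {mpoly K[m]} -> False.
  by move=> ki kj /mpolyX_inj E; move: uij; rewrite E (negbTE ki) (negbTE kj).
case: (eqVneq a i) => [->|ai]; case: (eqVneq b i) => [->|bi] //.
- by case: (eqVneq b j) => [->|bj] E; [case: (XN _ _ E)|case: (U b bi bj E)].
- by case: (eqVneq a j) => [->|aj] /esym E; [case: (XN _ _ E)|case: (U a ai aj E)].
- case: (eqVneq a j) => [->|aj]; case: (eqVneq b j) => [->|bj] //.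
  + by move/esym/XN.
  + by move/XN.
  + by move/mpolyX_inj.
Qed.

Lemma P_at_cancel lam c m (i j : 'I_m) : i != j ->
  P_at lam c (cancel_point i j 'X_i) = P_at lam c (cancel_point i j 'X_j).
Proof.
move=> nij; rewrite /P_at; case: ifP => // _; congr (_ * _).
apply: eq_bigr => w _.
set x := cancel_point i j 'X_i; set y := cancel_point i j 'X_j.
pose p := (w^-1)%g i; pose q := (w^-1)%g j.
have wp : w p = i by rewrite permKV.
have wq : w q = j by rewrite permKV.
have npq : p != q by rewrite (inj_eq perm_inj).
have xE k : k != p -> k != q -> x (w k) = y (w k).
  move=> kp kq; rewrite /x /y /cancel_point.
  have /negbTE -> : w k != i by rewrite -wp (inj_eq perm_inj).
  by have /negbTE -> : w k != j by rewrite -wq (inj_eq perm_inj).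
have xp u : cancel_point i j u (w p) = u by rewrite wp /cancel_point eqxx.
have xq u : cancel_point i j u (w q) = - u.
  by rewrite wq /cancel_point eq_sym (negbTE nij) eqxx.
case: (leqP (size lam) (minn p q)) => [|].
  rewrite leq_min => /andP[lp lq].
  have ne (k : 'I_m) : (k < size lam)%N -> (k != p) && (k != q).
    move=> kl; apply/andP; split; apply/eqP => E; move: kl; rewrite E ltnNge.
      by rewrite lp.
    by rewrite lq.
  congr (_ * _).
    by apply: eq_bigr => k /ne/andP[kp kq]; rewrite xE.
  apply: eq_bigr => k kl; have /andP[kp kq] := ne k kl.
  have F (z : 'I_m -> {mpoly K[m]}) (T : {mpoly K[m]}) :
      injective z -> z (w p) = T -> z (w q) = - T ->
     \prod_(j0 < m | (k < j0)%N)
       (tofrac (z (w k) + z (w j0)) / tofrac (z (w k) - z (w j0))) =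
     \prod_(j0 < m | [&& (k < j0)%N, j0 != p & j0 != q])
       (tofrac (z (w k) + z (w j0)) / tofrac (z (w k) - z (w j0))).
    move=> zI zp zq; rewrite (bigD1 p) /=; last exact: leq_trans lp.
    rewrite (bigD1 q) /=; last first.
      by rewrite eq_sym npq andbT; exact: leq_trans lq.
    rewrite mulrA zp zq opprK.
    have -> : tofrac (z (w k) + T) / tofrac (z (w k) - T) *
        (tofrac (z (w k) - T) / tofrac (z (w k) + T)) = 1.
      rewrite mulf_div [X in X / _]mulrC mulfV // mulf_neq0 // tofrac_eq0.
        by rewrite -zp subr_eq0; apply: contra_neq kp => /zI/perm_inj.
      rewrite -[T]opprK -zq subr_eq0; apply: contra_neq kq => /zI/perm_inj //.
    by rewrite mul1r; apply: eq_bigl => k'; rewrite andbA.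
  have Ix : injective x by apply: cancel_point_inj; rewrite // eqxx.
  have Iy : injective y by apply: cancel_point_inj; rewrite // eqxx orbT.
  rewrite (F x 'X_i Ix (xp _) (xq _)) (F y 'X_j Iy (xp _) (xq _)).
  by apply: eq_bigr => k' /and3P[_ kp' kq']; rewrite !xE.
have Z (u : {mpoly K[m]}) (a b : 'I_m) : (a < size lam)%N -> (a < b)%N ->
  cancel_point i j u (w a) + cancel_point i j u (w b) = 0 ->
  \prod_(i0 < m | (i0 < size lam)%N) \prod_(j0 < m | (i0 < j0)%N)
     (tofrac (cancel_point i j u (w i0) + cancel_point i j u (w j0)) /
      tofrac (cancel_point i j u (w i0) - cancel_point i j u (w j0))) = 0.
  move=> al ab e; rewrite (bigD1 a) //= (bigD1 b) //= e tofrac0 !mul0r //.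
rewrite gtn_min; case: (ltngtP p q) => [pq|qp|/val_inj pq].
- move=> h; have pl : (p < size lam)%N.
    by case/orP: h => // ql; exact: ltn_trans pq ql.
  by rewrite !(Z _ p q) ?mulr0 // xp xq addrN.
- move=> h; have ql : (q < size lam)%N.
    by case/orP: h => // pl; exact: ltn_trans qp pl.
  by rewrite !(Z _ q p) ?mulr0 // xp xq addNr.
- by rewrite pq eqxx in npq.
Qed.

Lemma P_poly_supersymmetric lam c m : supersymmetric (P_poly lam c m).
Proof.
split=> [|i j nij]; first exact: P_poly_sym.
have e : P_poly lam c m \mPo [tuple cancel_point i j 'X_i k | k < m] =
         P_poly lam c m \mPo [tuple cancel_point i j 'X_j k | k < m].
  have Ii : injective (cancel_point i j 'X_i).
    by apply: cancel_point_inj; rewrite // eqxx.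
  have Ij : injective (cancel_point i j 'X_j).
    by apply: cancel_point_inj; rewrite // eqxx orbT.
  apply/eqP; rewrite -tofrac_eq (P_poly_comp lam c Ii) (P_poly_comp lam c Ij).
  by rewrite P_at_cancel.
pose z := [tuple if k == j then 0 else 'X_k : {mpoly K[m]} | k < m].
have zX k : 'X_k \mPo z = if k == j then 0 else 'X_k.
  by rewrite comp_mpolyXU -tnth_nth tnth_mktuple.
have := congr1 (comp_mpoly z) e; rewrite !comp_mpoly_comp.
have -> : [tuple tnth [tuple cancel_point i j 'X_i k | k < m] i0 \mPo z | i0 < m]
        = [tuple cancel_point i j 'X_i k | k < m].
  apply: eq_mktuple => k; rewrite tnth_mktuple /cancel_point.
  case: eqP => _; first by rewrite zX (negbTE nij).
  case: eqVneq => kj; first by rewrite comp_mpolyN zX (negbTE nij).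
  by rewrite zX (negbTE kj).
have -> : [tuple tnth [tuple cancel_point i j 'X_j k | k < m] i0 \mPo z | i0 < m]
        = [tuple cancel_point i j 0 k | k < m].
  apply: eq_mktuple => k; rewrite tnth_mktuple /cancel_point.
  case: eqP => _; first by rewrite zX eqxx.
  case: eqVneq => kj; first by rewrite comp_mpolyN zX eqxx.
  by rewrite zX (negbTE kj).
by [].
Qed.

Lemma fact_power0 c n k : c 1%N = 0 -> (0 < k)%N ->
  fact_power c k (0 : {mpoly K[n]}) = 0.
Proof.
by move=> c1 k0; rewrite /fact_power big_ltn // c1 mpolyC0 subrr mul0r.
Qed.

Let x0 m (k : 'I_m.+1) : {mpoly K[m]} :=
  oapp (fun j : 'I_m => 'X_j) 0 (unlift ord_max k).

Lemma x0_lift m j : x0 (lift ord_max j) = 'X_j :> {mpoly K[m]}.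
Proof. by rewrite /x0 liftK. Qed.

Lemma x0_max m : x0 (@ord_max m) = 0.
Proof. by rewrite /x0 unlift_none. Qed.

Lemma mpolyX_neq0 m (j : 'I_m) : 'X_j != 0 :> {mpoly K[m]}.
Proof.
apply/eqP => /(congr1 (fun p => p@_U_(j))); rewrite mcoeff0 mcoeffXU eqxx.
by move/eqP; rewrite oner_eq0.
Qed.

Lemma x0_inj m : injective (@x0 m).
Proof.
move=> a b; case: (unliftP ord_max a) => [a'|] ->;
  case: (unliftP ord_max b) => [b'|] ->; rewrite ?x0_lift ?x0_max //.
- by move=> /mpolyX_inj ->.
- by move=> /eqP; rewrite (negbTE (mpolyX_neq0 _)).
- by move=> /esym/eqP; rewrite (negbTE (mpolyX_neq0 _)).
Qed.

Lemma P_at_stable lam c m : (forall i, i < size lam -> 0 < nth 0 lam i)%N ->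
  c 1%N = 0 ->
  P_at lam c (@x0 m) = P_at lam c (fun i : 'I_m => 'X_i : {mpoly K[m]}).
Proof.
move=> lam0 c1; rewrite /P_at; set l := size lam.
pose T n (x : 'I_n -> {mpoly K[m]}) (w : 'S_n) :=
  (\prod_(i < n | (i < l)%N) tofrac (fact_power c (nth 0%N lam i) (x (w i)))) *
  (\prod_(i < n | (i < l)%N) \prod_(j < n | (i < j)%N)
     (tofrac (x (w i) + x (w j)) / tofrac (x (w i) - x (w j)))).
have T0 (w : 'S_m.+1) : ((w^-1)%g ord_max < l)%N -> T _ (@x0 m) w = 0.
  move=> pl; rewrite /T (bigD1 ((w^-1)%g ord_max)) //= permKV x0_max.
  by rewrite fact_power0 ?lam0 // tofrac0 !mul0r.
have TL (p : 'I_m.+1) (w : 'S_m) : (l <= p)%N ->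
    T _ (@x0 m) (lift_perm p ord_max w) = T _ (fun i => 'X_i) w.
  move=> lp; have lb (i : 'I_m) : (bump p i < l)%N = (i < l)%N.
    rewrite /bump; case: (leqP p i) => pi; last by [].
    rewrite !ltnNge (leq_trans lp pi) add1n.
    by rewrite (leqW (leq_trans lp pi)).
  have nb (i : 'I_m) : (i < l)%N -> bump p i = i :> nat.
    by move=> il; rewrite /bump leqNgt (leq_trans il lp).
  have R (F : 'I_m.+1 -> {fraction {mpoly K[m]}}) :
      \prod_(i < m.+1 | (i < l)%N) F i =
      \prod_(i < m | (i < l)%N) F (lift p i).
    rewrite (reindex_omap (lift p) (unlift p)) /=.
      by apply: eq_bigl => i; rewrite liftK eqxx andbT lb.
    move=> i il; case: unliftP => [j ->//|E]; move: il.
    by rewrite E ltnNge lp.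
  rewrite /T !R; congr (_ * _); apply: eq_bigr => i il.
    by rewrite lift_perm_lift x0_lift /= nb.
  rewrite (bigD1_ord p) /=; last by rewrite nb //; exact: leq_trans lp.
  rewrite lift_perm_lift lift_perm_id x0_lift x0_max addr0 subr0.
  rewrite mulfV ?tofrac_eq0 ?mpolyX_neq0 // mul1r.
  apply: eq_big => [j|j _]; first by rewrite /bump !ltnNge leq_bump2.
  by rewrite lift_perm_lift x0_lift.
have sumT : \sum_(w : 'S_m.+1) T _ (@x0 m) w =
    (\sum_(w : 'S_m) T _ (fun i => 'X_i) w) *+ (m.+1 - l).
  rewrite (partition_big (fun w : 'S_m.+1 => (w^-1)%g ord_max) xpredT) //=.
  rewrite (bigID (fun p : 'I_m.+1 => (p < l)%N)) /= big1 ?add0r; last first.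
    move=> p pl; apply: big1 => w /eqP wp; rewrite T0 // wp //.
  rewrite (eq_bigr (fun=> \sum_(w : 'S_m) T _ (fun i => 'X_i) w)); last first.
    move=> p; rewrite -leqNgt => lp.
    rewrite (reindex (lift_perm p ord_max)) /=; last first.
      pose ulsf i (s : 'S_m.+1) k := odflt k (unlift (s i) (s (lift i k))).
      have ulsfK i (s : 'S_m.+1) k : lift (s i) (ulsf i s k) = s (lift i k).
        rewrite /ulsf; have:= neq_lift i k.
        by rewrite -(can_eq (permK s)) => /unlift_some[] ? ? ->.
      have inj_ulsf s : injective (ulsf p s).
        apply: can_inj (ulsf (s p) s^-1%g) _ => k'.
        by rewrite {1}/ulsf ulsfK !permK liftK.
      exists (fun s => perm (inj_ulsf s)) => [s _ | s].
        by apply/permP=> k'; rewrite permE /ulsf lift_perm_lift lift_perm_id liftK.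
      move=> /eqP si; have {}si : s p = ord_max by rewrite -si permKV.
      apply/permP=> k.
      case: (unliftP p k) => [k'|] ->; rewrite ?lift_perm_id //.
      by rewrite lift_perm_lift -si permE ulsfK.
    apply: eq_big => [w|w _]; last exact: TL.
    by rewrite -(inj_eq (@perm_inj _ (lift_perm p ord_max w))) permKV lift_perm_id eqxx.
  rewrite sumr_const; congr (_ *+ _); rewrite -sum1_card.
  rewrite (eq_bigl (fun p : 'I_m.+1 => (l <= p)%N)); last first.
    by move=> p; rewrite leqNgt.
  rewrite -(big_geq_mkord l m.+1 xpredT (fun=> 1%N)) /= sum_nat_const_nat muln1 //.
change ((if (l <= m.+1)%N then ((m.+1 - l)`!)%:R^-1 * \sum_(w : 'S_m.+1) T _ (@x0 m) w else 0)
  = (if (l <= m)%N then ((m - l)`!)%:R^-1 * \sum_(w : 'S_m) T _ (fun i => 'X_i) w else 0)).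
rewrite sumT; case: (leqP l m) => lm; last first.
  have -> : (m.+1 - l)%N = 0%N by apply/eqP; rewrite subn_eq0.
  by rewrite mulr0n mulr0; case: ifP.
rewrite leqW // subSn // factS natrM invfM.
rewrite -(mulr_natl (\sum_(w : 'S_m) T _ (fun i => 'X_i) w)) mulrA.
congr (_ * _).
rewrite mulrAC mulVf ?mul1r //.
rewrite -(rmorph_nat (tofrac (R:={mpoly K[m]}))) tofrac_eq0.
by rewrite -(rmorph_nat (@mpolyC m K)) mpolyC_eq0 pnatr_eq0.
Qed.

Lemma P_poly_stable lam c : (forall i, i < size lam -> 0 < nth 0 lam i)%N ->
  c 1%N = 0 -> stable (P_poly lam c).
Proof.
move=> lam0 c1 m; apply/eqP; rewrite -tofrac_eq.
by rewrite (P_poly_comp lam c (@x0_inj m)) P_at_stable // P_polyE.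
Qed.
End Super.

Section Gamma.
Variable K : numFieldType.

Definition poly_family := forall m, {mpoly K[m]}.
Implicit Types f g h : poly_family.

HB.instance Definition _ := Choice.copy poly_family (forall m, {mpoly K[m]}).

Let addA : associative (fun f g : poly_family => (fun m => f m + g m) : poly_family).
Proof. by move=> f g h; apply: functional_extensionality_dep => m; rewrite addrA. Qed.
Let addC : commutative (fun f g : poly_family => (fun m => f m + g m) : poly_family).
Proof. by move=> f g; apply: functional_extensionality_dep => m; rewrite addrC. Qed.
Let add0 : left_id ((fun m => 0) : poly_family)
  (fun f g : poly_family => (fun m => f m + g m) : poly_family).
Proof. by move=> f; apply: functional_extensionality_dep => m; rewrite add0r. Qed.
Let addN : left_inverse ((fun m => 0) : poly_family)
  (fun f : poly_family => (fun m => - f m) : poly_family)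
  (fun f g : poly_family => (fun m => f m + g m) : poly_family).
Proof. by move=> f; apply: functional_extensionality_dep => m; rewrite addNr. Qed.
HB.instance Definition _ := GRing.isZmodule.Build poly_family addA addC add0 addN.

Let mulA : associative (fun f g : poly_family => (fun m => f m * g m) : poly_family).
Proof. by move=> f g h; apply: functional_extensionality_dep => m; rewrite mulrA. Qed.
Let mulC : commutative (fun f g : poly_family => (fun m => f m * g m) : poly_family).
Proof. by move=> f g; apply: functional_extensionality_dep => m; rewrite mulrC. Qed.
Let mul1 : left_id ((fun m => 1) : poly_family)
  (fun f g : poly_family => (fun m => f m * g m) : poly_family).
Proof. by move=> f; apply: functional_extensionality_dep => m; rewrite mul1r. Qed.
Let mulD : left_distributive
  (fun f g : poly_family => (fun m => f m * g m) : poly_family) +%R.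
Proof. by move=> f g h; apply: functional_extensionality_dep => m; rewrite mulrDl. Qed.
Let one0 : ((fun m => 1) : poly_family) != 0.
Proof. by apply/eqP => /(congr1 (@^~ 0%N)) /eqP; rewrite oner_eq0. Qed.
HB.instance Definition _ :=
  GRing.Zmodule_isComNzRing.Build poly_family mulA mulC mul1 mulD one0.

Let scaleA (a b : K) f : (fun m => a *: (b *: f m)) = (fun m => (a * b) *: f m) :> poly_family.
Proof. by apply: functional_extensionality_dep => m; rewrite scalerA. Qed.
Let scale1 : left_id (1 : K) (fun a f => (fun m => a *: f m) : poly_family).
Proof. by move=> f; apply: functional_extensionality_dep => m; rewrite scale1r. Qed.
Let scaleDr : right_distributive (fun (a : K) f => (fun m => a *: f m) : poly_family) +%R.
Proof. by move=> a f g; apply: functional_extensionality_dep => m; rewrite scalerDr. Qed.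
Let scaleDl f : {morph (fun a : K => (fun m => a *: f m) : poly_family) : a b / a + b}.
Proof. by move=> a b; apply: functional_extensionality_dep => m; rewrite scalerDl. Qed.
HB.instance Definition _ :=
  GRing.Zmodule_isLmodule.Build K poly_family scaleA scale1 scaleDr scaleDl.

Let scaleAl (a : K) f g : a *: (f * g) = (a *: f) * g.
Proof. by apply: functional_extensionality_dep => m; exact: scalerAl. Qed.
HB.instance Definition _ := GRing.Lmodule_isLalgebra.Build K poly_family scaleAl.
HB.instance Definition _ := GRing.Lalgebra_isComAlgebra.Build K poly_family.

Definition Gamma_pred : {pred poly_family} :=
  fun f => `[< (forall m, supersymmetric (f m)) /\ stable f >].

Lemma Gamma_pred_subalg : subalg_closed Gamma_pred.
Proof.
split.
- apply/asboolP; split=> m.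
    split=> [|i j _]; first by apply/issymP => s; exact: msym1.
    by rewrite [LHS]comp_mpoly1 [RHS]comp_mpoly1.
  exact: comp_mpoly1.
- move=> a f g /asboolP[fS fT] /asboolP[gS gT]; apply/asboolP.
  split=> m.
    have [fs fc] := fS m; have [gs gc] := gS m; rewrite /supersymmetric.
    change ((a *: f + g) m) with (a *: f m + g m).
    split=> [|i j ij]; first by rewrite rpredD ?rpredZ.
    by rewrite !comp_mpolyD !comp_mpolyZ fc ?gc.
  change ((a *: f + g) m.+1) with (a *: f m.+1 + g m.+1).
  change ((a *: f + g) m) with (a *: f m + g m).
  by rewrite comp_mpolyD comp_mpolyZ fT gT.
- move=> f g /asboolP[fS fT] /asboolP[gS gT]; apply/asboolP.
  split=> m.
    have [fs fc] := fS m; have [gs gc] := gS m; rewrite /supersymmetric.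
    change ((f * g) m) with (f m * g m).
    split=> [|i j ij]; first by rewrite rpredM.
    by rewrite !(rmorphM (comp_mpoly _)) /= fc ?gc.
  change ((f * g) m.+1) with (f m.+1 * g m.+1).
  change ((f * g) m) with (f m * g m).
  by rewrite (rmorphM (comp_mpoly _)) /= fT gT.
Qed.

Record Gamma := MkGamma { gfun :> poly_family; _ : gfun \in Gamma_pred }.

HB.instance Definition _ := [isSub for gfun].
HB.instance Definition _ := [Choice of Gamma by <:].
HB.instance Definition _ :=
  GRing.SubChoice_isSubAlgebra.Build K poly_family Gamma_pred Gamma
    Gamma_pred_subalg.
HB.instance Definition _ :=
  GRing.SubPzRing_isSubComPzRing.Build poly_family Gamma_pred Gamma.

Lemma P_in_Gamma (lam : strict_partition) (c : nat -> K) : c 1%N = 0 ->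
  (P_poly lam c : poly_family) \in Gamma_pred.
Proof.
move=> c1; apply/asboolP; split; first by move=> m; exact: P_poly_supersymmetric.
by apply: P_poly_stable => //; exact: strict_partition_gt0.
Qed.

Definition P_fun (lam : strict_partition) (c : nat -> K) (c1 : c 1%N = 0) :
    Gamma := MkGamma (P_in_Gamma lam c1).

Definition Q_fun (lam : strict_partition) (c : nat -> K) (c1 : c 1%N = 0) :
    Gamma := (2 ^+ size lam : K) *: P_fun lam c1.
End Gamma.

Section Coefficients.
Variable K : numFieldType.
Implicit Types (a b : nat -> K) (y z : seq K).

(* The coefficient of t^k in prod_{u in z} (1 + u t) / prod_{u in y} (1 - u t).
   Each geometric series 1 / (1 - u t) is truncated after t^k, which does not
   change this coefficient; super_h_gen is the generating function identity
   with the denominator cleared. *)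
Definition super_h (k : nat) (y z : seq K) : K :=
  ((\prod_(u <- z) (1 + u *: 'X)) *
   (\prod_(u <- y) \sum_(i < k.+1) (u *: 'X) ^+ i))`_k.

Lemma super_h_gen y z k :
  \sum_(i < k.+1) (\prod_(u <- y) (1 - u *: 'X))`_i * super_h (k - i) y z =
  (\prod_(u <- z) (1 + u *: 'X))`_k.
Proof.
pose E d (p q : {poly K}) := forall i, (i <= d)%N -> p`_i = q`_i.
have EM d p1 q1 p2 q2 : E d p1 q1 -> E d p2 q2 -> E d (p1 * p2) (q1 * q2).
  move=> e1 e2 i id; rewrite !coefM; apply: eq_bigr => j _.
  rewrite e1 ?e2 //; first exact: leq_trans (leq_subr _ _) id.
  by apply: leq_trans id; rewrite -ltnS.
have Eprod d (F G : K -> {poly K}) : (forall u, E d (F u) (G u)) ->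
    E d (\prod_(u <- y) F u) (\prod_(u <- y) G u).
  move=> FG; elim: y => [|u s IH]; first by rewrite !big_nil.
  by rewrite !big_cons; apply: EM.
set N := \prod_(u <- z) _; set D := \prod_(u <- y) _.
pose G d := \prod_(u <- y) \sum_(i < d.+1) (u *: 'X) ^+ i : {poly K}.
have coefG u d j : (\sum_(i < d.+1) (u *: 'X) ^+ i : {poly K})`_j =
    if (j <= d)%N then u ^+ j else 0.
  rewrite coef_sum; under eq_bigr do rewrite exprZn coefZ coefXn.
  case: leqP => jd; last first.
    apply: big1 => i _; case: eqP => [e|]; last by rewrite mulr0.
    by move: (ltn_ord i); rewrite -e ltnNge jd.
  rewrite (bigD1 (Ordinal (jd : (j < d.+1)%N))) //= eqxx mulr1 big1 ?addr0 //.
  move=> i ij; case: eqP => [e|]; last by rewrite mulr0.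
  by case/eqP: ij; apply: val_inj.
have hE j : (j <= k)%N -> super_h j y z = (N * G k)`_j.
  move=> jk; rewrite /super_h -/(G j) -/N; apply: (EM j) => //.
  apply: Eprod => u i ij; rewrite !coefG ij (leq_trans ij jk) //.
under eq_bigr => i _ do rewrite hE ?leq_subr //.
rewrite -(coefM D) mulrCA.
have -> : D * G k = \prod_(u <- y) (1 - (u *: 'X) ^+ k.+1).
  rewrite /D /G -big_split /=; apply: eq_bigr => u _.
  by rewrite -[in RHS](expr1n _ k.+1) subrXX; congr (_ * _);
     apply: eq_bigr => i _; rewrite expr1n mul1r.
have one : \prod_(u <- y) (1 : {poly K}) = 1 by rewrite big1.
rewrite -[in RHS](mulr1 N) -[in RHS]one; apply: (EM k) => //.
apply: (Eprod k (fun u => 1 - (u *: 'X) ^+ k.+1) (fun=> 1)) => u i ik.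
by rewrite coefB exprZn coefZ coefXn ltn_eqF ?ltnS // mulr0 subr0.
Qed.

(* iota 2 r' lists 2, ..., r' + 1 and iota 2 r.-1 lists 2, ..., r. *)
Definition d_coef (a b : nat -> K) (r r' : nat) : K :=
  if (r < r')%N then 0
  else super_h (r - r') [seq b i | i <- iota 2 r'] [seq - a i | i <- iota 2 r.-1].

Definition d_det (a b : nat -> K) (mu nu : seq nat) : K :=
  \det (\matrix_(i < size mu, j < size mu)
          d_coef a b (nth 0%N mu i) (nth 0%N nu j)).
End Coefficients.

(* Main.v *)
Require Import Defs.
From mathcomp Require Import all_boot all_order all_algebra all_fingroup.
From mathcomp Require Import boolp classical_sets fsbigop cardinality reals.
From mathcomp Require Import complex fraction mpoly zify ring.

(** The coefficients d_{rt} satisfy the recurrence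
    d_{r+1,t} = d_{r,t-1} + (b_{t+1} - a_{r+1}) d_{r,t}, so by Newton
    interpolation (x|a)^r = sum_t d_{rt} (x|b)^t for r >= 1. Substituting this
    in the symmetrization formula of P_{mu;a} and expanding the product gives a
    sum over all exponent vectors (t_1, ..., t_l). The symmetrization is
    alternating in its exponents, because prod_{i<j} (x_i+x_j)/(x_i-x_j) is:
    vectors with a repeated entry contribute 0, and the permutations of a strict
    partition nu add up to det(d_{mu_i,nu_j}) P_{nu;b}. *)

Set Implicit Arguments.
Unset Strict Implicit.
Unset Printing Implicit Defensive.

Import GRing.Theory Num.Theory.
Local Open Scope ring_scope.

(** * Change of basis between factorial powers *)

Section FactorialPowers.
Variable K : numFieldType.
Implicit Types (a b : nat -> K) (y z : seq K).

Lemma prod_geometric_stable y d d' i : (i <= d)%N -> (i <= d')%N ->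
  (\prod_(u <- y) \sum_(j < d.+1) (u *: 'X) ^+ j : {poly K})`_i =
  (\prod_(u <- y) \sum_(j < d'.+1) (u *: 'X) ^+ j)`_i.
Proof.
elim: y i => [|u y IH] i id id'; first by rewrite !big_nil.
have geoE e n : (n <= e)%N ->
    (\sum_(j < e.+1) (u *: 'X) ^+ j : {poly K})`_n = u ^+ n.
  move=> ne; under eq_bigr do rewrite exprZn.
  have := coef_poly e.+1 (fun j => u ^+ j) n.
  by rewrite poly_def ltnS ne.
rewrite !big_cons !coefM; apply: eq_bigr => j _.
have ji : (j <= i)%N by rewrite -ltnS.
rewrite !geoE ?(leq_trans ji) //; congr (_ * _).
by apply: IH; apply: leq_trans (leq_subr _ _) _.
Qed.

(** Lets values of [super_h] of different degrees be compared at one truncation order. *)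
Lemma super_h_trunc d k y z : (k <= d)%N ->
  super_h k y z =
  ((\prod_(u <- z) (1 + u *: 'X)) *
   (\prod_(u <- y) \sum_(i < d.+1) (u *: 'X) ^+ i))`_k.
Proof.
move=> kd; rewrite /super_h !coefM; apply: eq_bigr => j _; congr (_ * _).
by apply: prod_geometric_stable; rewrite ?(leq_trans (leq_subr _ _) kd) ?leq_subr.
Qed.

Lemma super_h0 y z : super_h 0 y z = 1.
Proof.
rewrite /super_h -horner_coef0 hornerM !horner_prod !big1 ?mulr1 // => u _.
  by rewrite big_ord1 hornerE.
by rewrite !hornerE.
Qed.

Lemma super_h_rconsr k y z u :
  super_h k.+1 y (rcons z u) = super_h k.+1 y z + u * super_h k y z.
Proof.
rewrite (super_h_trunc y (rcons z u) (leqnn k.+1)) (super_h_trunc y z (leqnn k.+1)).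
rewrite (super_h_trunc y z (leqnSn k)) big_rcons /= -mulrA mulrCA.
by rewrite mulrC mulrDr mulr1 -scalerAr coefD coefZ coefMX /=.
Qed.

(** The generating function satisfies G = G' + v t G, where G' omits the factor 1/(1 - v t); compare
    coefficients of t^(k+1). *)
Lemma super_h_rconsl k y z v :
  super_h k.+1 (rcons y v) z = super_h k.+1 y z + v * super_h k (rcons y v) z.
Proof.
rewrite (super_h_trunc y z (leqnn k.+1)) (super_h_trunc _ z (leqnSn k)).
rewrite (super_h_trunc (rcons y v) z (leqnn k.+1)) big_rcons /=.
set p := \prod_(u <- z) _; set q := \prod_(u <- y) _; set g := \sum_(i < _) _.
(* This is (1 - v X) g = 1 - (v X)^(k+2), a truncated geometric series; the error term has too high
   a degree to reach coefficient k+1. *)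
have gE : g = 1 - (v *: 'X) ^+ k.+2 + v *: (g * 'X).
  apply/eqP; rewrite -subr_eq scalerAr -{1}[g]mulr1 -mulrBr mulrC.
  rewrite -[in eqbRHS](expr1n _ k.+2) subrXX.
  by apply/eqP; congr (_ * _); apply: eq_bigr => i _; rewrite expr1n mul1r.
rewrite {1}gE.
have -> : p * (q * (1 - (v *: 'X) ^+ k.+2 + v *: (g * 'X))) =
  p * q - (v ^+ k.+2) *: (p * q * 'X^(k.+2)) + v *: (p * (q * g) * 'X).
  by rewrite exprZn -!mul_polyC; ring.
by rewrite coefD coefB !coefZ coefMXn coefMX /= ltnSn mulr0 subr0.
Qed.

Lemma iota_rcons m n : iota m n.+1 = rcons (iota m n) (m + n)%N.
Proof. by rewrite -cats1 -addn1 iotaD. Qed.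

Lemma d_coef_diag a b r : d_coef a b r r = 1.
Proof. by rewrite /d_coef ltnn subnn super_h0. Qed.

Lemma d_coef_gt a b r t : (r < t)%N -> d_coef a b r t = 0.
Proof. by rewrite /d_coef => ->. Qed.

Lemma size_prod_linear z :
  (size (\prod_(u <- z) (1 + u *: 'X) : {poly K})%R <= (size z).+1)%N.
Proof.
elim: z => [|u z IH]; first by rewrite big_nil size_poly1.
rewrite big_cons; apply: leq_trans (size_polyMleq _ _) _.
have : (size (1 + u *: 'X : {poly K})%R <= 2)%N.
  apply: leq_trans (size_polyD _ _) _; rewrite size_poly1 geq_max /=.
  by apply: leq_trans (size_scale_leq _ _) _; rewrite size_polyX.
by move: IH => /=; lia.
Qed.

(** No b occurs, so the generating function is a product of r linear factors and has no term of
    degree r+1. *)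
Lemma d_coefr0 a b r : d_coef a b r.+1 0 = 0.
Proof.
rewrite /d_coef ltn0 subn0 /super_h big_nil mulr1 nth_default //.
by apply: leq_trans (size_prod_linear _) _; rewrite size_map size_iota.
Qed.

(** Strip a_{r+2} by [super_h_rconsr], then b_{t+2} from the leading term by [super_h_rconsl]. *)
Lemma d_coefS a b r t :
  d_coef a b r.+2 t.+1 =
  d_coef a b r.+1 t + (b t.+2 - a r.+2) * d_coef a b r.+1 t.+1.
Proof.
case: (ltngtP t r.+1) => tr.
- rewrite /d_coef; have [-> -> ->] : [/\ (r.+2 < t.+1)%N = false,
    (r.+1 < t)%N = false & (r.+1 < t.+1)%N = false] by split; lia.
  rewrite -[r.+2.-1]/(r.+1) [iota 2 r.+1]iota_rcons [iota 2 t.+1]iota_rcons !map_rcons /=.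
  by rewrite subSS -(subnSK tr) super_h_rconsr super_h_rconsl mulrBl mulNr addrA.
- by rewrite !d_coef_gt ?mulr0 ?addr0 // ltnW.
- by rewrite tr !d_coef_diag d_coef_gt // mulr0 addr0.
Qed.

Lemma fact_powerS (c : nat -> K) n k (x : {mpoly K[n]}) :
  fact_power c k.+1 x = fact_power c k x * (x - (c k.+1)%:MP).
Proof. by rewrite /fact_power big_nat_recr. Qed.

(** Induction on r; at r = 0 both sides are x because a_1 = b_1 = 0. Terms with t > r vanish, so one
    bound [N] can serve all parts of mu. *)
Lemma fact_power_change a b n (x : {mpoly K[n]}) N r :
  a 1%N = 0 -> b 1%N = 0 -> (r < N)%N ->
  fact_power a r.+1 x =
  \sum_(t < N) d_coef a b r.+1 t.+1 *: fact_power b t.+1 x.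
Proof.
move=> a1 b1; elim: r N => [|r IH] [//|N] rN.
  rewrite big_ord_recl big1 => [|i _]; last by rewrite d_coef_gt ?scale0r.
  by rewrite d_coef_diag scale1r addr0 /fact_power !big_nat1 a1 b1.
rewrite fact_powerS (IH N) // mulr_suml.
(* Splits x - a_{r+2} as (x - b_{t+2}) + (b_{t+2} - a_{r+2}), matching the two terms of
   [d_coefS]. *)
have E (t : nat) : d_coef a b r.+1 t.+1 *: fact_power b t.+1 x * (x - (a r.+2)%:MP)
   = d_coef a b r.+1 t.+1 *: fact_power b t.+2 x
   + ((b t.+2 - a r.+2) * d_coef a b r.+1 t.+1) *: fact_power b t.+1 x.
  rewrite (fact_powerS b t.+1) -!mul_mpolyC !mpolyCM mpolyCB.
  ring.
under eq_bigr do rewrite E.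
rewrite big_split /=.
under [RHS]eq_bigr do rewrite d_coefS scalerDl.
rewrite big_split /=; congr (_ + _).
  (* The raised powers start at exponent 2; on the right, the term of exponent 1 carries d_{r+1,0} =
     0. *)
  by rewrite big_ord_recl d_coefr0 scale0r add0r.
by rewrite big_ord_recr /= d_coef_gt // mulr0 scale0r addr0.
Qed.
End FactorialPowers.

(** * Products over pairs of indices under a permutation *)

Lemma prod_lt_sym_perm (R : comPzRingType) l (g : 'I_l -> 'I_l -> R) (s : 'S_l) :
  (forall i j, g i j = g j i) ->
  \prod_(i < l) \prod_(j < l | (i < j)%N) g (s i) (s j) =
  \prod_(i < l) \prod_(j < l | (i < j)%N) g i j.
Proof.
(* [h t] sends an increasing pair to its image under t, put in increasing order; it permutes the
   increasing pairs, with inverse [h t^-1]. *)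
move=> gC; pose h (t : 'S_l) (p : 'I_l * 'I_l) :=
  if (t p.1 < t p.2)%N then (t p.1, t p.2) else (t p.2, t p.1).
have hK t : {in [pred p : 'I_l * 'I_l | (p.1 < p.2)%N], cancel (h t) (h t^-1%g)}.
  move=> [i j]; rewrite inE /= => ij; rewrite /h /=.
  by case: (ltnP (t i) (t j)) => /= _; rewrite !permK ?ij // ltnNge ltnW.
have h_lt t (p : 'I_l * 'I_l) : (p.1 < p.2)%N -> ((h t p).1 < (h t p).2)%N.
  case: p => i j /= ij; rewrite /h /=; case: (ltnP (t i) (t j)) => //= ji.
  rewrite ltn_neqAle ji andbT; apply: contraTneq ij => /val_inj/perm_inj ->.
  by rewrite ltnn.
rewrite !pair_big_dep /= [RHS](reindex_onto (h s) (h s^-1%g)) /=; last first.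
  by move=> p pl; rewrite -{1}(invgK s) hK.
apply: eq_big => [p|[i j] ij].
  apply/idP/andP => [pl|[hl /eqP <-]]; last exact: h_lt.
  by split; [apply: h_lt | rewrite hK].
by rewrite /h /=; case: ifP => //= _; rewrite gC.
Qed.

Lemma prod_lt_subr_perm (R : comNzRingType) l (y : 'I_l -> R) (s : 'S_l) :
  \prod_(i < l) \prod_(j < l | (i < j)%N) (y (s i) - y (s j)) =
  (-1) ^+ s * \prod_(i < l) \prod_(j < l | (i < j)%N) (y i - y j).
Proof.
(* A Vandermonde determinant in the -z_i; permuting the variables permutes its columns. *)
have vanE (z : 'I_l -> R) : \prod_(i < l) \prod_(j < l | (i < j)%N) (z i - z j) =
    \det (Vandermonde l (\row_i - z i)).
  rewrite det_Vandermonde; apply: eq_bigr => i _; apply: eq_bigr => j _.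
  by rewrite !mxE opprK addrC.
rewrite !vanE -[in RHS]odd_permV -det_perm mulrC -det_mulmx -col_permE.
by congr (\det _); apply/matrixP => i j; rewrite !mxE.
Qed.

Lemma prod_lt_ratio_perm (F : fieldType) l (y : 'I_l -> F) (s : 'S_l) :
  \prod_(i < l) \prod_(j < l | (i < j)%N)
     ((y (s i) + y (s j)) / (y (s i) - y (s j))) =
  (-1) ^+ s * \prod_(i < l) \prod_(j < l | (i < j)%N)
                 ((y i + y j) / (y i - y j)).
Proof.
have splitE (z : 'I_l -> F) :
    \prod_(i < l) \prod_(j < l | (i < j)%N) ((z i + z j) / (z i - z j)) =
    (\prod_(i < l) \prod_(j < l | (i < j)%N) (z i + z j)) /
    \prod_(i < l) \prod_(j < l | (i < j)%N) (z i - z j).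
  by rewrite -prodf_div; apply: eq_bigr => i _; rewrite -prodf_div.
rewrite (splitE (fun i => y (s i))) splitE.
rewrite (prod_lt_sym_perm (g := fun i j => y i + y j)); last first.
  by move=> i j; rewrite addrC.
by rewrite prod_lt_subr_perm invfM invr_sign mulrCA.
Qed.

(** * The symmetrization as a multilinear alternating function *)

Section SymmetrizedSum.
Variables (F : fieldType) (l k : nat) (y : 'I_(l + k) -> F).
Implicit Types (f : 'I_l -> 'I_(l + k) -> F) (w : 'S_(l + k)) (s : 'S_l).

Definition ratio (i j : 'I_(l + k)) : F := (y i + y j) / (y i - y j).

(** The ratios over i < l, i < j in P_lambda, cut at j = l: the first product is alternating under
    S_l, the second symmetric. *)
Definition pair_kernel w : F :=
  \prod_(i < l) ((\prod_(j < l | (i < j)%N) ratio (w (lshift k i)) (w (lshift k j))) *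
                 \prod_(j < k) ratio (w (lshift k i)) (w (rshift l j))).

(** The sum over S(m), m = l + k, in P_lambda, with arbitrary functions in place of the factorial
    powers; this makes it multilinear in [f]. *)
Definition symsum f : F :=
  \sum_(w : 'S_(l + k)) (\prod_(i < l) f i (w (lshift k i))) * pair_kernel w.

Definition block_fun s (i : 'I_(l + k)) : 'I_(l + k) :=
  match split i with inl j => lshift k (s j) | inr j => rshift l j end.

Lemma block_fun_inj s : injective (block_fun s).
Proof.
apply: (can_inj (g := block_fun s^-1%g)) => i; rewrite {2}/block_fun.
by case: split_ordP => j ->; rewrite /block_fun;
  [rewrite (unsplitK (inl _)) permK | rewrite (unsplitK (inr _))].
Qed.

Definition block_perm s : 'S_(l + k) := perm (@block_fun_inj s).

Lemma block_perml s i : block_perm s (lshift k i) = lshift k (s i).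
Proof. by rewrite permE /block_fun (unsplitK (inl i)). Qed.

Lemma block_permr s j : block_perm s (rshift l j) = rshift l j.
Proof. by rewrite permE /block_fun (unsplitK (inr j)). Qed.

Lemma pair_kernel_perm s w : pair_kernel (block_perm s * w)%g = (-1) ^+ s * pair_kernel w.
Proof.
rewrite /pair_kernel !big_split /= mulrA; congr (_ * _).
  rewrite -(prod_lt_ratio_perm (fun i => y (w (lshift k i)))).
  by apply: eq_bigr => i _; apply: eq_bigr => j _; rewrite !permM !block_perml.
rewrite [RHS](reindex_inj (@perm_inj _ s)); apply: eq_bigr => i _.
by apply: eq_bigr => j _; rewrite !permM block_perml block_permr.
Qed.

(** Translating w by [block_perm s] moves s from the functions to the kernel, which yields the
    sign. *)
Lemma symsum_perm s f : symsum (f \o s) = (-1) ^+ s * symsum f.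
Proof.
rewrite /symsum (reindex_inj (mulgI (block_perm s))) /= mulr_sumr.
apply: eq_bigr => w _; rewrite pair_kernel_perm mulrCA; congr (_ * (_ * _)).
rewrite [RHS](reindex_inj (@perm_inj _ s)); apply: eq_bigr => i _ /=.
by rewrite permM block_perml.
Qed.

Lemma symsum_eq0 f i j : (2 : F) != 0 -> i != j -> f i = f j -> symsum f = 0.
Proof.
move=> F2 ij fij; have fE : f \o tperm i j =1 f.
  by move=> x /=; case: tpermP => [->|->|].
have := symsum_perm (tperm i j) f; rewrite odd_tperm ij expr1 mulN1r.
have -> : symsum (f \o tperm i j) = symsum f.
  by apply: eq_bigr => w _; congr (_ * _); apply: eq_bigr => x _; rewrite fE.
move/eqP; rewrite -addr_eq0 -mulr2n -mulr_natl mulf_eq0 (negbTE F2).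
by move/eqP.
Qed.

Lemma symsum_sum N (A : 'I_l -> 'I_N -> F) (g : 'I_N -> 'I_(l + k) -> F) :
  symsum (fun i v => \sum_(t < N) A i t * g t v) =
  \sum_(e : {ffun 'I_l -> 'I_N}) (\prod_(i < l) A i (e i)) * symsum (fun i => g (e i)).
Proof.
under [RHS]eq_bigr do rewrite mulr_sumr.
rewrite exchange_big /=; apply: eq_bigr => w _.
rewrite bigA_distr_bigA mulr_suml; apply: eq_bigr => e _.
by rewrite big_split /= mulrA.
Qed.
End SymmetrizedSum.

(** * Strict partitions and the regrouping of exponent vectors *)

Lemma strict_partition_gtn (lam : strict_partition) : sorted gtn lam.
Proof. by case: lam => s /= /andP[]. Qed.

Lemma strict_partition_uniq (lam : strict_partition) : uniq lam.
Proof. by have := strict_partition_gtn lam; rewrite gtn_sorted_uniq_geq => /andP[]. Qed.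

Lemma strict_partition_nth_le (lam : strict_partition) i j :
  (i <= j < size lam)%N -> (nth 0 lam j <= nth 0 lam i)%N.
Proof.
move=> /andP[ij jl]; have := strict_partition_gtn lam.
rewrite gtn_sorted_uniq_geq => /andP[_ lam_geq].
have geqT : transitive geq by move=> x y z /= xy yz; apply: leq_trans yz xy.
by apply: (sorted_leq_nth geqT leqnn 0%N lam_geq); rewrite ?inE // (leq_ltn_trans ij).
Qed.

Lemma strict_partition_perm_inj (lam nu : strict_partition) :
  perm_eq lam nu -> lam = nu.
Proof.
move=> /perm_mem e; apply: val_inj; apply: (@irr_sorted_eq _ gtn) e.
- by move=> x y z /= xy yz; apply: ltn_trans yz xy.
- exact: ltnn.
- exact: strict_partition_gtn.
- exact: strict_partition_gtn.
Qed.

Lemma perm_eq_nth_perm l (e : 'I_l -> nat) (nu : seq nat) :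
  size nu = l -> perm_eq [seq e i | i <- enum 'I_l] nu ->
  exists s : 'S_l, forall i, e i = nth 0%N nu (s i).
Proof.
move=> /eqP sz; rewrite -[nu]/(val (Tuple sz)) => /tuple_permP[s es].
exists s => i; have := congr1 (fun u => nth 0%N u i) es.
by rewrite (nth_map i) ?size_enum_ord // nth_ord_enum -tnth_nth tnth_mktuple (tnth_nth 0%N).
Qed.

(* Pigeonhole: if mu_i < nu_i, then s^-1 would map {0, ..., i} into {0, ..., i-1}. *)
Lemma part_sub_perm (mu nu : strict_partition) (s : 'S_(size mu)) :
  size nu = size mu ->
  (forall i, nth 0 nu (s i) <= nth 0 mu i)%N -> part_sub nu mu.
Proof.
move=> sz le_s; split=> [|i0]; rewrite sz // => il; pose i := Ordinal il.
rewrite leqNgt; apply/negP => lt_i.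
have /proper_card : [set k : 'I_(size mu) | (k < i)%N] \proper
                    [set k : 'I_(size mu) | (k <= i)%N].
  apply/properP; split; first by apply/fintype.subsetP => k; rewrite !inE => /ltnW.
  by exists i; rewrite !inE ?ltnn.
rewrite ltnNge -(card_imset _ (@perm_inj _ s^-1%g)) => /negP; apply.
apply/subset_leq_card/fintype.subsetP => y /imsetP[j jin ->]; move: jin; rewrite !inE => ji.
rewrite ltnNge; apply/negP => ij.
have := le_s (s^-1%g j); rewrite permKV leqNgt => /negP; apply.
apply: leq_ltn_trans (leq_trans lt_i _).
  by apply: strict_partition_nth_le; rewrite ij /=.
by apply: strict_partition_nth_le; rewrite ji /= sz.
Qed.

(** The surviving vectors are grouped by the strict partition obtained by sorting. The fibre over nu
    is the set of rearrangements of nu, and its sum is the Leibniz expansion of the determinant. *)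
Lemma sum_alternating_det (R : comNzRingType) (mu : strict_partition) N
    (d : nat -> nat -> R) (h : ('I_(size mu) -> nat) -> R) (r : seq strict_partition) :
  uniq r -> (forall nu, nu \in r <-> size nu = size mu /\ part_sub nu mu) ->
  (forall i, i < size mu -> nth 0 mu i <= N)%N ->
  (forall r t, (r < t)%N -> d r t = 0) ->
  (forall p q, p =1 q -> h p = h q) ->
  (forall p (s : 'S_(size mu)), h (p \o s) = (-1) ^+ s * h p) ->
  (forall p i j, i != j -> p i = p j -> h p = 0) ->
  \sum_(e : {ffun 'I_(size mu) -> 'I_N.+1})
    (\prod_(i < size mu) d (nth 0%N mu i) (e i).+1) * h (fun i => (e i).+1) =
  \sum_(nu <- r)
    \det (\matrix_(i < size mu, j < size mu) d (nth 0%N mu i) (nth 0%N nu j)) *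
    h (fun i => nth 0%N nu i).
Proof.
move=> r_uniq r_mem mu_le d0 h_ext h_perm h_inj; set l := size mu.
pose X (e : {ffun 'I_l -> 'I_N.+1}) :=
  (\prod_(i < size mu) d (nth 0%N mu i) (e i).+1) * h (fun i => (e i).+1).
pose cod (e : {ffun 'I_l -> 'I_N.+1}) := [seq (e i).+1 | i <- enum 'I_l].
(* The default value [mu] is junk, taken only when [e] is not injective. *)
pose srt e : strict_partition := insubd mu (sort geq (cod e)).
have srtP (e : {ffun 'I_l -> 'I_N.+1}) : injective e -> perm_eq (cod e) (srt e).
  move=> eI; rewrite -(perm_sort geq); rewrite insubdK //.
  rewrite unfold_in gtn_sorted_uniq_geq sort_uniq sort_sorted ?andbT; last first.
    by move=> x y /=; exact: leq_total.
  rewrite map_inj_uniq ?enum_uniq ?andbT /=; last first.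
    by move=> i j [] /val_inj/eI.
  by rewrite all_sort; apply/allP => _ /mapP[i _ ->].
have srtE (e : {ffun 'I_l -> 'I_N.+1}) nu : injective e -> (srt e == nu) = perm_eq (cod e) nu.
  move=> eI; apply/eqP/idP => [<-|]; first exact: srtP.
  by rewrite (permPl (srtP e eI)) => /strict_partition_perm_inj.
(* [e i] stores the exponent minus 1, so the bound says that exponent i is at most mu_i. Outside [Q]
   either [h] or a factor [d] vanishes; on [Q], [part_sub_perm] gives a partition in [r]. *)
pose Q (e : {ffun 'I_l -> 'I_N.+1}) :=
  injectiveb e && [forall i : 'I_l, (e i < nth 0%N mu i)%N].
have X0 e : ~~ Q e -> X e = 0.
  rewrite negb_and => /orP[/injectivePn[i [j ij eij]]|/fintype.forallPn[j]].
    by rewrite /X (h_inj _ i j) ?mulr0 // eij.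
  by rewrite -leqNgt => ej; rewrite /X (bigD1 j) //= d0 ?mul0r.
have srt_in e : Q e -> srt e \in r.
  move=> /andP[/injectiveP eI /fintype.forallP le_e].
  have sz : size (srt e) = l.
    by rewrite -(perm_size (srtP e eI)) size_map size_enum_ord.
  apply/r_mem; split=> //.
  have [s es] := perm_eq_nth_perm sz (srtP e eI).
  by apply: (part_sub_perm (s := s)) => // i; rewrite -es.
rewrite -/X (bigID Q) /= [X in _ + X]big1 ?addr0 //.
transitivity (\sum_(e | Q e) \sum_(nu <- r | srt e == nu) X e).
  apply: eq_bigr => e Qe; rewrite (eq_bigl (pred1 (srt e))); last first.
    by move=> nu; rewrite /= eq_sym.
  by rewrite -[RHS]big_filter filter_pred1_uniq ?srt_in // big_seq1.
rewrite (exchange_big_dep xpredT) //=; apply: eq_big_seq => nu.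
move=> /r_mem[sz [_ nu_le]].
have nu_lt (i : 'I_l) : ((nth 0 nu i).-1 < N.+1)%N.
  by rewrite ltnS (leq_trans (leq_pred _)) // (leq_trans (nu_le _ _)) ?sz // mu_le.
(* The rearrangement of nu by s; [.-1] accounts for the shift, and [nu_lt] keeps [inord] off its
   default value. *)
pose f (s : 'S_l) : {ffun 'I_l -> 'I_N.+1} := [ffun i => inord (nth 0%N nu (s i)).-1].
have fE s i : (f s i).+1 = nth 0%N nu (s i).
  by rewrite ffunE inordK // prednK // strict_partition_gt0 // sz.
have f_inj : injective f.
  move=> s s' ff; apply/permP => i; apply/ord_inj/eqP.
  by rewrite -(nth_uniq 0%N _ _ (strict_partition_uniq nu)) ?sz // -!fE ff.
have fI s : injective (f s).
  move=> i j /(congr1 (fun t => (nat_of_ord t).+1)); rewrite !fE => /eqP.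
  by rewrite nth_uniq ?sz ?strict_partition_uniq // => /eqP/val_inj/perm_inj.
have f_srt s : srt (f s) = nu.
  apply/eqP; rewrite srtE //; apply: uniq_perm.
  - by rewrite map_inj_uniq ?enum_uniq // => i j [] /val_inj/fI.
  - exact: strict_partition_uniq.
  move=> t; apply/mapP/idP => [[i _ ->]|/(nthP 0%N)[j]]; first by rewrite fE mem_nth // sz.
  rewrite sz => jl <-; exists (s^-1%g (Ordinal jl)); first by rewrite mem_enum.
  by rewrite fE permKV.
(* Weakening [Q] to injectivity adds only zero terms and completes the fibre to all
   rearrangements. *)
transitivity (\sum_(e : {ffun 'I_l -> 'I_N.+1} | injectiveb e && (srt e == nu)) X e).
  rewrite [RHS](bigID Q) /= [X in _ + X]big1 ?addr0; last by move=> e /andP[_ /X0].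
  by apply: eq_bigl => e; rewrite /Q; case: injectiveb; rewrite //= andbC.
transitivity (\sum_(s : 'S_l) X (f s)).
  rewrite [RHS](partition_big f (fun e : {ffun 'I_l -> 'I_N.+1} =>
    injectiveb e && (srt e == nu))) /=; last first.
    by move=> s _; rewrite f_srt eqxx andbT; apply/injectiveP.
  apply: eq_bigr => e /andP[/injectiveP eI]; rewrite srtE // => /(perm_eq_nth_perm sz)[s es].
  have -> : e = f s.
    by apply/ffunP => i; apply/ord_inj/eqP; rewrite -eqSS fE es.
  by rewrite (big_pred1 s) // => s'; rewrite /= (inj_eq f_inj).
rewrite mulr_suml; apply: eq_bigr => s _.
(* The sign from [h_perm] is the sign of s in the Leibniz formula. *)
rewrite /X (h_ext _ ((fun i : 'I_l => nth 0%N nu i) \o s)) ?h_perm => [|i]; last exact: fE.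
rewrite mulrCA mulrA; congr (_ * _ * _).
by apply: eq_bigr => i _; rewrite mxE fE.
Qed.

(** * Expansion of the defining formula of P *)

Lemma fraction_natf_neq0 (K : numFieldType) n k :
  (k.+1%:R : {fraction {mpoly K[n]}}) != 0.
Proof.
rewrite -(rmorph_nat (tofrac (R:={mpoly K[n]}))) tofrac_eq0.
by rewrite -(rmorph_nat (@mpolyC n K)) mpolyC_eq0 pnatr_eq0.
Qed.

Lemma P_at_small (K : numFieldType) lam (c : nat -> K) m n
    (x : 'I_m -> {mpoly K[n]}) : (m < size lam)%N -> P_at lam c x = 0.
Proof. by rewrite /P_at ltnNge => /negbTE ->. Qed.

(** Cut the indices at l: i < l selects the left block, and then i < j holds for all j in the right
    block. *)
Lemma P_at_symsum (K : numFieldType) lam (c : nat -> K) l k n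
    (x : 'I_(l + k) -> {mpoly K[n]}) : size lam = l ->
  P_at lam c x = (k`!)%:R^-1 *
    symsum (fun i => tofrac (x i))
      (fun i v => tofrac (fact_power c (nth 0%N lam i) (x v))).
Proof.
move=> sz; rewrite /P_at sz leq_addr addKn /symsum; congr (_ * _).
have R (G : 'I_(l + k) -> {fraction {mpoly K[n]}}) :
    \prod_(i < l + k | (i < l)%N) G i = \prod_(i < l) G (lshift k i).
  rewrite big_split_ord /= [X in _ * X]big_pred0 ?mulr1 => [|i].
    by apply: eq_bigl => i; rewrite ltn_ord.
  by rewrite ltnNge leq_addr.
apply: eq_bigr => w _; rewrite !R; congr (_ * _).
apply: eq_bigr => i _; rewrite big_split_ord /=; congr (_ * _).
  by apply: eq_bigr => j _; rewrite rmorphD rmorphB.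
apply: eq_big => [j|j _]; first by rewrite ltn_addr.
by rewrite /ratio rmorphD rmorphB.
Qed.

Lemma P_at_change (K : numFieldType) (a b : nat -> K) n m
    (x : 'I_m -> {mpoly K[n]}) (mu : strict_partition) (r : seq strict_partition) :
  a 1%N = 0 -> b 1%N = 0 ->
  uniq r -> (forall nu, nu \in r <-> size nu = size mu /\ part_sub nu mu) ->
  P_at mu a x = \sum_(nu <- r) tofrac (d_det a b mu nu)%:MP * P_at nu b x.
Proof.
(* All nu have the length of mu: with too few variables both sides are 0, otherwise the factor 1/k!
   is common. *)
move=> a1 b1 r_uniq r_mem; case: (leqP (size mu) m) => lm; last first.
  rewrite P_at_small //; apply/esym/big1_seq => nu /= /r_mem[sz _].
  by rewrite P_at_small ?sz // mulr0.
move: x; rewrite -(subnKC lm); move: (m - size mu)%N => k x.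
rewrite (P_at_symsum _ _ (erefl (size mu))).
pose y i := tofrac (x i).
pose N := \max_(i < size mu) nth 0%N mu i.
have mu_le i : (i < size mu)%N -> (nth 0 mu i <= N)%N.
  by move=> il; exact: (leq_bigmax (F := fun j : 'I_(size mu) => nth 0%N mu j) (Ordinal il)).
pose d s t := tofrac (d_coef a b s t)%:MP : {fraction {mpoly K[n]}}.
pose h (p : 'I_(size mu) -> nat) :=
  symsum y (fun i v => tofrac (fact_power b (p i) (x v))).
have symsum_ext f g : (forall i v, f i v = g i v) -> symsum y f = symsum y g :> {fraction _}.
  move=> fg; apply: eq_bigr => w _; congr (_ * _).
  by apply: eq_bigr => i _; rewrite fg.
rewrite (symsum_ext _ (fun i v =>
    \sum_(t < N.+1) d (nth 0%N mu i) t.+1 * tofrac (fact_power b t.+1 (x v)))); last first.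
  move=> i v; have := strict_partition_gt0 (ltn_ord i).
  have := mu_le i (ltn_ord i); case: (nth 0%N mu i) => // s sN _.
  rewrite (@fact_power_change _ a b _ _ N.+1) // ?(leqW sN) // rmorph_sum.
  by apply: eq_bigr => t _; rewrite -tofracM mul_mpolyC.
rewrite symsum_sum (sum_alternating_det (d := d) (h := h) r_uniq r_mem) //.
- rewrite mulr_sumr; apply: eq_big_seq => nu /r_mem[sz _].
  rewrite (P_at_symsum _ _ sz) mulrCA; congr (_ * _).
  rewrite /d_det -!det_map_mx; congr (\det _).
  by apply/matrixP => i j; rewrite !mxE.
- by move=> s t st; rewrite /d d_coef_gt // mpolyC0 tofrac0.
- by move=> p q pq; apply: symsum_ext => i v; rewrite pq.
- move=> p s; rewrite -[RHS]symsum_perm; exact: symsum_ext.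
- move=> p i j ij pij; have F2 := fraction_natf_neq0 K n 1.
  apply: (@symsum_eq0 _ _ _ y _ i j F2 ij).
  by rewrite pij.
Qed.

(** * Passage to the algebra of supersymmetric functions *)

Local Open Scope classical_set_scope.

Theorem theorem10p2 (R : realType) (a b : nat -> R[i])
    (a1 : a 1%N = 0) (b1 : b 1%N = 0) (mu : strict_partition) :
  Q_fun mu a1 =
  \sum_(nu \in [set nu : strict_partition |
                  size nu = size mu /\ part_sub nu mu])
    d_det a b mu nu *: Q_fun nu b1.
Proof.
have [s s_set] := (finite_seqP _).1 (finite_subpartitions mu).
pose r := undup s.
have r_mem nu : nu \in r <-> size nu = size mu /\ part_sub nu mu.
  by rewrite mem_undup -[_ /\ _]/([set nu : strict_partition |
       size nu = size mu /\ part_sub nu mu]%classic nu) s_set.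
rewrite (_ : mkset _ = [set` r]%classic); last first.
  by apply/seteqP; split=> nu /r_mem.
(* Equality in [Gamma] is checked for each number m of variables. *)
rewrite -fsbig_seq ?undup_uniq //; apply: val_inj.
apply: functional_extensionality_dep => m.
rewrite (big_morph (fun g : Gamma _ => (\val g : poly_family _) m) (id1 := 0) (op1 := +%R)) //.
rewrite -[LHS]/(2 ^+ size mu *: P_poly mu a m).
rewrite (eq_big_seq (fun nu : strict_partition =>
    2 ^+ size mu *: (d_det a b mu nu *: P_poly nu b m))); last first.
  by move=> nu /r_mem[sz _]; rewrite scalerA mulrC -scalerA -sz.
(* The powers of 2 agree since the lengths do; injectivity of [tofrac] moves the identity to the
   fraction field. *)
rewrite -scaler_sumr; congr (_ *: _); apply/eqP; rewrite -tofrac_eq; apply/eqP.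
rewrite P_polyE (P_at_change _ a1 b1 (undup_uniq s) r_mem) rmorph_sum /=.
by apply: eq_bigr => nu _; rewrite -mul_mpolyC tofracM P_polyE.
Qed.
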